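(* For all integers $\alpha \geq 0$ and $n \geq 0$, $$PD_2\bigl(2^\alpha(4n+3)\bigr) \equiv 0 \pmod{4}.$$
   Context: A partition with designated summands of weight $n$ is an ordinary integer partition of $n$ in which, for each part size that occurs, exactly one of the occurrences (copies) of that part is designated (marked). $PD_2(n)$ denotes the number of partitions with designated summands of weight $n$ in which all parts are odd (with $PD_2(0)=1$); for example $PD_2(4)=5$, counting $3'+1'$, $1'+1+1+1$, $1+1'+1+1$, $1+1+1'+1$, $1+1+1+1'$. Its generating function is $\sum_{n\ge 0} PD_2(n)q^n = \frac{f_4 f_6^2}{f_1 f_3 f_{12}}$, where $f_r = \prod_{m\ge 1}(1-q^{rm})$. *)

(* Defs.v *)
From mathcomp Require Import all_boot.

Set Implicit Arguments.
Unset Strict Implicit.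
Unset Printing Implicit Defensive.

(* A partition with designated summands is listed in nonincreasing order; each
   entry is a copy of a part together with a mark telling whether that copy is
   the designated one.  Copies of equal parts are distinguished only by their
   position, so that 1' + 1 and 1 + 1' are two different sequences. *)
Definition designated_partition (n : nat) (s : seq (nat * bool)) : bool :=
  let parts := unzip1 s in
  [&& sorted geq parts, 0 \notin parts, sumn parts == n
    & all (fun k => count_mem (k, true) s == 1) parts].

Definition odd_designated_partition (n : nat) (s : seq (nat * bool)) : bool :=
  designated_partition n s && all odd (unzip1 s).

Definition forget_bounds (n : nat) (s : {bseq n of 'I_n.+1 * bool}) :
    seq (nat * bool) :=
  [seq (nat_of_ord x.1, x.2) | x <- s].

(* A partition of n has at most n parts, each at most n, so counting inside
   this finite type loses nothing: see forget_bounds_inj and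
   designated_partition_bounded. *)
Definition PD2 (n : nat) : nat :=
  #|[set s : {bseq n of 'I_n.+1 * bool} |
      odd_designated_partition n (forget_bounds s)]|.

Lemma forget_bounds_inj (n : nat) : injective (@forget_bounds n).
Proof.
move=> s t /inj_map eq_st; apply/val_inj/eq_st => -[i a] [j b] /= [ij ->].
by congr (_, _); apply: val_inj.
Qed.

Lemma designated_partition_bounded (n : nat) (s : seq (nat * bool)) :
  designated_partition n s -> exists t, @forget_bounds n t = s.
Proof.
case/and4P => _ pos0 /eqP <- _.
have le_size : size s <= sumn (unzip1 s).
  elim: s pos0 => //= -[k b] s IHs; rewrite inE negb_or eq_sym -lt0n /=.
  by case/andP => k_gt0 /IHs le_s; rewrite -add1n leq_add.
have le_part x : x \in s -> x.1 <= sumn (unzip1 s).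
  elim: {pos0 le_size} s => //= y s IHs; rewrite inE => /predU1P[->|/IHs le_x].
    exact: leq_addr.
  exact: leq_trans le_x (leq_addl _ _).
set m := sumn _ in le_size le_part *.
pose u : seq ('I_m.+1 * bool) := [seq (inord x.1, x.2) | x <- s].
have size_u : size u <= m by rewrite size_map.
exists (Bseq size_u); rewrite /forget_bounds /= -map_comp -[RHS]map_id.
apply/eq_in_map => -[k b] s_kb /=.
by rewrite inordK // ltnS (le_part _ s_kb).
Qed.

(* Main.v *)
Require Import Defs.
From mathcomp Require Import all_boot all_algebra all_field.
From mathcomp Require Import zify ring.

(** Modulo 4 the series A(q) = sum_n PD2(n) q^n is a product of two theta
    series, each supported on perfect squares.  Hence PD2(N) is divisible by 4
    whenever N is not a sum of two squares, and 2^alpha (4n+3) never is one.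

    Choosing the multiplicity m of an odd part v and which of its m copies is
    designated contributes the factor
      1 + sum_(m >= 1) m q^(vm) = (1 - q^v + q^(2v)) / (1 - q^v)^2,
    so that A(q) D(q) = T(q), where
      D(q) = prod_(v odd) (1 - q^v)^2,  T(q) = prod_(v odd) (1 - q^v + q^(2v)).
    Both D and T are specializations of prod_(v odd) (z + q^v)(1 + z q^v) up to
    a power of z: z = -1 gives D, and z a primitive cube root of unity gives T.
    By the Jacobi triple product, with P(q) = prod_(k >= 1) (1 - q^(2k)),
      P D = sum_(j in Z) (-1)^j q^(j^2) = 1 + 2 S,
      P T = sum_(j in Z) z^j q^(j^2).
    Therefore A (1 + 2S) = P T, and as (1 + 2S)^2 is 1 modulo 4, the series A is
    congruent to (P T)(1 + 2S), a product of two series supported on squares.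

    All of this takes place in polynomials over the integers modulo a power
    of 'X: [coef_block_series_prod] is the generating function,
    [finite_triple_product] a finite, exact form of the triple product,
    [triple_product_mod] its truncation, [cube_root_theta] and
    [minus_one_theta] the two specializations, and [PD2_mod4] puts them
    together. *)

Set Implicit Arguments.
Unset Strict Implicit.
Unset Printing Implicit Defensive.

Import GRing.Theory.

(** * Decomposing a partition along its largest possible part *)

(** The [m.+1] copies of [v], the one at position [p <= m] being designated. *)
Definition marked_block (v m p : nat) : seq (nat * bool) :=
  nseq p (v, false) ++ (v, true) :: nseq (m - p) (v, false).

(** The pairs [(m, p)] for which a block of [m.+1] copies of [v] marked at [p]
    fits in a partition of [N]. *)
Definition block_shapes (v N : nat) : seq (nat * nat) :=
  [seq (m, p) | m <- [seq m <- iota 0 N | v * m.+1 <= N], p <- iota 0 m.+1].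

(** An explicit enumeration, following the recursion on the [k] admissible part
    sizes 1, 3, ..., 2k-1, from which the generating function is read off. *)
Fixpoint odd_designated (k N : nat) : seq (seq (nat * bool)) :=
  if k is k'.+1 then
    odd_designated k' N ++
    [seq marked_block k'.*2.+1 mp.1 mp.2 ++ s |
       mp <- block_shapes k'.*2.+1 N,
       s <- odd_designated k' (N - k'.*2.+1 * mp.1.+1)]
  else if N == 0 then [:: [::]] else [::].

Lemma mem_block_shapes v N mp :
  (mp \in block_shapes v N) =
  [&& mp.2 <= mp.1, mp.1 < N & v * mp.1.+1 <= N].
Proof.
case: mp => m p; apply/allpairsPdep/and3P => [[m' [p' [+ + [-> ->]]]] | [pm mN vN]].
  by rewrite mem_filter !mem_iota !add0n ltnS => /andP[].
exists m, p; rewrite mem_filter !mem_iota !add0n ltnS.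
by move: pm mN vN => /= -> -> ->.
Qed.

Lemma unzip1_marked_block v m p :
  p <= m -> unzip1 (marked_block v m p) = nseq m.+1 v.
Proof.
move=> lepm; rewrite /unzip1 map_cat /= !map_nseq /= -[v :: _]/(nseq (m - p).+1 v).
by rewrite -nseqD addnS subnKC.
Qed.

Lemma count_marked_block v m p : count_mem (v, true) (marked_block v m p) = 1.
Proof. by rewrite count_cat /= !count_nseq /= !xpair_eqE eqxx. Qed.

Definition parts_below (k : nat) (s : seq (nat * bool)) :=
  all (fun j => j < k.*2) (unzip1 s).

Lemma marked_block_partition k m p N s : p <= m ->
  let v := k.*2.+1 in
  v * m.+1 <= N ->
  odd_designated_partition (N - v * m.+1) s && parts_below k s ->
  odd_designated_partition N (marked_block v m p ++ s) &&
  parts_below k.+1 (marked_block v m p ++ s).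
Proof.
move=> lepm v leN /andP[/andP[/and4P[srt pos0 /eqP sums uniq_mark] odds] below].
have vNs : v \notin unzip1 s.
  by apply/negP => /(allP below); rewrite /v; lia.
have geqT : transitive geq by move=> a b c /= ab bc; apply: leq_trans bc ab.
have bE := unzip1_marked_block v lepm.
rewrite /odd_designated_partition /designated_partition /parts_below.
have -> : unzip1 (marked_block v m p ++ s) = nseq m.+1 v ++ unzip1 s.
  by rewrite -bE /unzip1 map_cat.
apply/andP; split; [apply/andP; split; [apply/and4P; split|]|].
- rewrite (sorted_pairwise geqT) pairwise_cat -!(sorted_pairwise geqT) srt andbT.
  apply/andP; split; last first.
    by elim: (m) => //= j ->; rewrite leqnn.
  apply/allrelP => x y /nseqP[-> _] /(allP below) /=; rewrite /v; lia.
- by rewrite mem_cat negb_or pos0 andbT; apply/negP => /nseqP[].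
- by rewrite sumn_cat sumn_nseq sums subnKC.
- apply/allP => j; rewrite mem_cat => /orP[/nseqP[-> _]|js].
    rewrite count_cat count_marked_block (_ : count_mem _ s = 0) //.
    apply/eqP; rewrite -leqn0 leqNgt -has_count has_pred1; apply: contra vNs => vs.
    exact: (map_f fst vs).
  have jv : j != v by apply: contraNneq vNs => <-.
  rewrite count_cat (eqP (allP uniq_mark _ js)) (_ : count_mem _ _ = 0) //.
  by rewrite count_cat /= !count_nseq /= !xpair_eqE eq_sym (negPf jv).
- by rewrite all_cat odds all_nseq /= odd_double.
- rewrite all_cat all_nseq /v /=; apply/andP; split; first by lia.
  by apply: sub_all below => j; lia.
Qed.

Lemma split_largest_part v (s : seq (nat * bool)) :
  sorted geq (unzip1 s) -> all (fun j => j <= v) (unzip1 s) ->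
  s = [seq x <- s | x.1 == v] ++ [seq x <- s | x.1 != v].
Proof.
have geqT : transitive geq by move=> a b c /= ab bc; apply: leq_trans bc ab.
rewrite (sorted_pairwise geqT); elim: s => //= x s IHs /andP[lex srt] /andP[lexv le_s].
case: eqP => [xv | /eqP xv] /=; first by rewrite -IHs.
have lt_s y : y \in s -> (y.1 != v).
  by move=> ys; have /= := allP lex _ (map_f fst ys); move: xv lexv; lia.
rewrite (eq_in_filter (a2 := pred0)) => [|y /lt_s/negPf //].
by rewrite filter_pred0 /=; congr (_ :: _); rewrite (eq_in_filter lt_s) filter_predT.
Qed.

Lemma marked_block_of_count v (b : seq (nat * bool)) :
  all (fun x => x.1 == v) b -> count_mem (v, true) b = 1 ->
  exists m p, p <= m /\ b = marked_block v m p.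
Proof.
move=> bv b1; have : (v, true) \in b by rewrite -has_pred1 has_count b1.
move=> vb; case/splitPr: vb bv b1 => b1 b2.
rewrite all_cat count_cat /= eqxx => /andP[b1v b2v] /eqP.
rewrite eqxx add1n addnS eqSS addn_eq0 => /andP[/eqP b1n /eqP b2n].
have plain c : all (fun x => x.1 == v) c -> count_mem (v, true) c = 0 ->
    c = nseq (size c) (v, false).
  move=> cv c0; apply/all_pred1P/allP => -[j [|]] jc; have /= /eqP jv := allP cv _ jc.
    by have : has (pred1 (v, true)) c; [rewrite has_pred1 -jv | rewrite has_count c0].
  by rewrite jv eqxx.
exists (size b1 + size b2), (size b1); split; first exact: leq_addr.
rewrite /marked_block addKn -!plain //.
Qed.

(** In the nonincreasing order the copies of 2k+1 form a prefix, and their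
    single mark makes that prefix a marked block; the remaining parts, being odd
    and different from 2k+1, are at most 2k-1. *)
Lemma mem_odd_designated k N s :
  (s \in odd_designated k N) = odd_designated_partition N s && parts_below k s.
Proof.
elim: k N s => [|k IHk] N s.
  rewrite /=; apply/idP/andP => [|[/andP[/and4P[_ _ /eqP <- _] _]]].
    by case: eqP => // ->; rewrite inE => /eqP->.
  by case: s => // x s; rewrite /parts_below /=.
rewrite /= mem_cat; apply/orP/idP => [[|/allpairsPdep[mp [s' [+ +]]]] | sP].
- rewrite IHk => /andP[-> /=]; apply: sub_all => j; lia.
- rewrite mem_block_shapes IHk => /and3P[pm _ vN] s'P ->.
  exact: marked_block_partition.
have /andP[/andP[/and4P[srt pos0 /eqP sums uniq_mark] odds] below] := sP.
set v := k.*2.+1 in sP *.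
have lev : all (fun j => j <= v) (unzip1 s).
  by apply: sub_all below => j /=; rewrite /v; lia.
have := split_largest_part srt lev.
set b := [seq x <- s | x.1 == v]; set r := [seq x <- s | x.1 != v] => sE.
have rP : parts_below k r.
  apply/allP => _ /mapP[x + ->]; rewrite mem_filter => /andP[xv xs].
  have odd_lt j : odd j -> j < k.+1.*2 -> j != k.*2.+1 -> j < k.*2 by lia.
  by apply: odd_lt => //; [apply/(allP odds)/map_f | apply/(allP below)/map_f].
have rodd : all odd (unzip1 r).
  by move: odds; rewrite sE /unzip1 map_cat all_cat => /andP[].
have rdes : designated_partition (sumn (unzip1 r)) r.
  apply/and4P; split => //.
  - apply: (subseq_sorted _ _ srt); last by apply/map_subseq/filter_subseq.
    by move=> a c d /= ab bc; apply: leq_trans bc ab.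
  - by move: pos0; rewrite sE /unzip1 map_cat mem_cat negb_or => /andP[].
  apply/allP => j jr.
  have jv : j != v by move/(allP rP): jr; rewrite /v; lia.
  have := allP uniq_mark j; rewrite {1 2}sE /unzip1 map_cat mem_cat jr orbT count_cat.
  move/(_ isT); rewrite (_ : count_mem _ b = 0) //.
  apply/eqP; rewrite -leqn0 leqNgt -has_count has_pred1.
  by rewrite mem_filter /= (negPf jv).
have [b0 | b_neq0] := eqVneq b [::].
  left; rewrite IHk; move: sE; rewrite b0 /= => sE.
  by rewrite sE rP /odd_designated_partition rodd -sums sE rdes.
right.
have bv : all (fun x => x.1 == v) b by apply: filter_all.
have vb : v \in unzip1 s.
  case: (b) b_neq0 sE bv => //= x b' _ -> /= /andP[/eqP <- _].
  by rewrite inE eqxx.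
have b1 : count_mem (v, true) b = 1.
  have := allP uniq_mark _ vb; rewrite {1}sE count_cat => /eqP.
  rewrite (_ : count_mem _ r = 0) ?addn0 //.
  apply/eqP; rewrite -leqn0 leqNgt -has_count has_pred1.
  by rewrite mem_filter /= eqxx.
have [m [p [pm bE]]] := marked_block_of_count bv b1.
have sumsE : N = v * m.+1 + sumn (unzip1 r).
  by rewrite -sums {1}sE bE {1}/unzip1 map_cat -!/(unzip1 _) unzip1_marked_block //
    sumn_cat sumn_nseq.
apply/allpairsPdep; exists (m, p), r; rewrite mem_block_shapes -bE -sE IHk /=; split => //.
  by rewrite pm sumsE leq_addr andbT /v; nia.
by rewrite rP andbT sumsE addKn /odd_designated_partition rdes rodd.
Qed.

(** The position of the mark recovers [p], and the number of copies of [v]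
    recovers [m]. *)
Lemma marked_block_inj v m p m' p' s s' :
  p <= m -> p' <= m' -> v \notin unzip1 s -> v \notin unzip1 s' ->
  marked_block v m p ++ s = marked_block v m' p' ++ s' ->
  [/\ m = m', p = p' & s = s'].
Proof.
move=> pm pm' vs vs' E.
have pE : p = p'.
  have idx q n t : index (v, true) (marked_block v n q ++ t) = q.
    rewrite -catA index_cat mem_nseq xpair_eqE andbF /= size_nseq eqxx addn0.
    by rewrite andbF.
  by rewrite -(idx p m s) E idx.
have mE : m = m'.
  have cnt q n t : q <= n -> v \notin unzip1 t ->
      count_mem v (unzip1 (marked_block v n q ++ t)) = n.+1.
    move=> qn /count_memPn t0.
    rewrite /unzip1 map_cat -!/(unzip1 _) unzip1_marked_block // count_cat t0.
    by rewrite count_nseq /= eqxx mul1n addn0.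
  by apply: succn_inj; rewrite -(cnt p m s) // E cnt.
split=> //; move/eqP: E; rewrite pE mE eqseq_cat // => /andP[_ /eqP].
by [].
Qed.

Lemma odd_designated_uniq k N : uniq (odd_designated k N).
Proof.
elim: k N => [|k IHk] N; first by rewrite /=; case: eqP.
have fresh M s : s \in odd_designated k M -> k.*2.+1 \notin unzip1 s.
  rewrite mem_odd_designated => /andP[_ below].
  by apply/negP => /(allP below); lia.
rewrite /= cat_uniq IHk /=; apply/andP; split.
  apply/hasPn => _ /allpairsPdep[mp [s [+ _ ->]]].
  rewrite mem_block_shapes => /andP[pm _]; apply/negP => /fresh.
  by rewrite /unzip1 map_cat -!/(unzip1 _) unzip1_marked_block // mem_cat mem_head.
apply: allpairs_uniq_dep => [|mp _|]; last 1 first.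
- move=> _ _ /allpairsPdep[[m p] [s [+ + ->]]] /allpairsPdep[[m' p'] [s' [+ + ->]]] /=.
  rewrite !mem_block_shapes => /andP[pm _] /fresh vs /andP[pm' _] /fresh vs' E.
  by have /= [-> -> ->] := marked_block_inj pm pm' vs vs' E.
- apply: allpairs_uniq_dep => [|m _|]; rewrite ?filter_uniq ?iota_uniq //.
  by move=> [m p] [m' p'] _ _ /= [-> ->].
- exact: IHk.
Qed.

Lemma size_odd_designatedS k N :
  size (odd_designated k.+1 N) =
  size (odd_designated k N) +
  \sum_(m < N | k.*2.+1 * m.+1 <= N)
     m.+1 * size (odd_designated k (N - k.*2.+1 * m.+1)).
Proof.
rewrite /= size_cat size_allpairs_dep sumnE big_map big_allpairs_dep big_filter /=.
congr (_ + _); rewrite -[N in iota 0 N]subn0 -/(index_iota 0 N) big_mkord.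
apply: eq_bigr => m _.
by rewrite big_const_seq count_predT /= size_iota -iterS iter_addn_0 mulnC.
Qed.

(** A partition of [N] has all its parts at most [N], so restricting them to be
    less than 2k loses nothing. *)
Lemma PD2_odd_designated k N : N < k.*2 -> PD2 N = size (odd_designated k N).
Proof.
move=> ltNk; rewrite /PD2 cardE -(size_map (@forget_bounds N)).
apply/perm_size/uniq_perm; rewrite ?odd_designated_uniq //.
  by rewrite (map_inj_uniq (@forget_bounds_inj N)) enum_uniq.
move=> s; rewrite mem_odd_designated; apply/mapP/andP => [[t + ->]|[sP _]].
  rewrite mem_enum inE => tP; split => //.
  apply/allP => _ /mapP[_ /mapP[x _ ->] ->] /=.
  exact: leq_ltn_trans (leq_ord _) ltNk.
have /andP[/designated_partition_bounded[t tE] _] := sP.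
by exists t; rewrite // mem_enum inE tE.
Qed.

(** * The generating function *)

Local Open Scope ring_scope.

(** A block of [m.+1] copies of [v] can be marked in [m.+1] ways; the
    omitted terms, those with [m >= M], have degree above [M] as soon as [v] is
    positive. *)
Definition block_series (M v : nat) : {poly int} :=
  1 + \sum_(m < M) (m.+1)%:R *: 'X^(v * m.+1).

Lemma coef_block_series_prod k N M : (N <= M)%N ->
  (\prod_(j < k) block_series M j.*2.+1)`_N = (size (odd_designated k N))%:R.
Proof.
elim: k N => [|k IHk] N leNM.
  by rewrite big_ord0 coef1 /=; case: eqP.
rewrite size_odd_designatedS natrD big_ord_recr /=.
rewrite [block_series M k.*2.+1]/block_series mulrDr mulr1 coefD IHk //.
congr (_ + _); rewrite mulr_sumr coef_sum natr_sum.
rewrite (big_ord_widen_cond M (fun m => k.*2.+1 * m.+1 <= N)%N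
  (fun m => (m.+1 * size (odd_designated k (N - k.*2.+1 * m.+1)))%:R)) //.
rewrite [RHS]big_mkcond /=; apply: eq_bigr => m _.
rewrite -scalerAr coefZ coefMXn; case: ltnP => leN.
  by rewrite mulr0.
rewrite IHk ?natrM; last by apply: leq_trans leNM; apply: leq_subr.
by rewrite ifT //; nia.
Qed.

(** Truncated form of 1 + x / (1 - x)^2 = (1 - x + x^2) / (1 - x)^2, with the
    exact error term that makes the induction go through. *)
Lemma block_series_mul M v :
  block_series M v * (1 - 'X^v) ^+ 2 =
  1 - 'X^v + 'X^v ^+ 2 - ((M.+1)%:R - M%:R * 'X^v) * 'X^v ^+ M.+1.
Proof.
elim: M => [|M IHM]; first by rewrite /block_series big_ord0 expr1; ring.
rewrite /block_series big_ord_recr addrA mulrDl -/(block_series M v) IHM /=.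
rewrite -mul_polyC -polyC_natr exprM; rewrite !exprS; ring.
Qed.

(** * Gaussian binomials and the finite triple product *)

Section Gauss.
Variable R : comNzRingType.
Implicit Types (t a b : R) (m n i j : nat).

Fixpoint gauss_binomial t m i : R :=
  match m, i with
  | _, 0 => 1
  | 0, _.+1 => 0
  | m'.+1, i'.+1 => gauss_binomial t m' i' + t ^+ i * gauss_binomial t m' i
  end.

Definition pochhammer t n : R := \prod_(i < n) (1 - t ^+ i.+1).

Lemma pochhammerS t n : pochhammer t n.+1 = pochhammer t n * (1 - t ^+ n.+1).
Proof. by rewrite /pochhammer big_ord_recr. Qed.

Lemma gauss_binomial0 t m : gauss_binomial t m 0 = 1.
Proof. by case: m. Qed.

Lemma gauss_binomial_small t m i : (m < i)%N -> gauss_binomial t m i = 0.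
Proof.
elim: m i => [|m IHm] [|i] //= lt_mi.
by rewrite !IHm ?mulr0 ?addr0 // ltnW.
Qed.

(** The factorial formula for Gaussian binomials, multiplied out since [t] lives
    in a ring without division. *)
Lemma gauss_binomial_pochhammer t i j :
  gauss_binomial t (i + j) i * (pochhammer t i * pochhammer t j) =
  pochhammer t (i + j).
Proof.
have [m Em] := ubnP (i + j)%N; elim: m i j Em => // m IHm [|i] j lt_ijm.
  by rewrite gauss_binomial0 /pochhammer big_ord0 !mul1r.
rewrite addSn /= mulrDl.
have -> : gauss_binomial t (i + j) i * (pochhammer t i.+1 * pochhammer t j) =
          (1 - t ^+ i.+1) * pochhammer t (i + j).
  by rewrite -IHm; [rewrite pochhammerS; ring | lia].
case: j lt_ijm => [|j] lt_ijm.
  by rewrite addn0 gauss_binomial_small // mulr0 mul0r addr0 pochhammerS mulrC.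
have -> : t ^+ i.+1 * gauss_binomial t (i + j.+1) i.+1 *
            (pochhammer t i.+1 * pochhammer t j.+1) =
          t ^+ i.+1 * (1 - t ^+ j.+1) * pochhammer t (i + j.+1).
  by rewrite addnS -addSn -IHm; [rewrite (pochhammerS _ j); ring | lia].
rewrite pochhammerS.
have -> : (i + j.+1).+1 = (i.+1 + j.+1)%N by lia.
by rewrite exprD; ring.
Qed.

(** Homogeneous form, so that no negative power of [t] is needed when the
    product is centred. *)
Lemma gauss_binomial_theorem t a b m :
  \prod_(k < m) (a + b * t ^+ k) =
  \sum_(i < m.+1) gauss_binomial t m i * t ^+ 'C(i, 2) * a ^+ (m - i) * b ^+ i.
Proof.
elim: m b => [|m IHm] b.
  by rewrite big_ord0 big_ord1 /= !expr0 !mulr1.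
rewrite big_ord_recl expr0 mulr1.
under eq_bigr => k _ do rewrite lift0 exprS mulrA.
rewrite IHm mulrDl [RHS]big_ord_recl big_distrr /= big_ord_recl.
rewrite [X in _ = _ + X]
  (_ : _ = \sum_(i < m.+1) (a * (gauss_binomial t m i.+1 * t ^+ 'C(i.+1, 2)
      * a ^+ (m - i.+1) * (b * t) ^+ i.+1) +
      b * (gauss_binomial t m i * t ^+ 'C(i, 2) * a ^+ (m - i) * (b * t) ^+ i))).
  rewrite big_split /= addrA; congr (_ + _); last by rewrite big_distrr.
  rewrite [in RHS]big_ord_recr /= (gauss_binomial_small _ (ltnSn m)).
  rewrite !(mulr0, mul0r) addr0.
  rewrite !gauss_binomial0 !subn0 !expr0 exprS; congr (_ + _); ring.
apply: eq_bigr => i _; rewrite /bump leq0n !add1n ?add0n subSS /= binS bin1.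
case: (ltnP i m) => [lt_im | le_mi].
  by rewrite -(subnSK lt_im) exprD !exprMn !exprS; ring.
rewrite (@gauss_binomial_small t m i.+1) ?ltnS // !(mulr0, mul0r) !add0r.
by rewrite exprD exprMn exprS; ring.
Qed.
End Gauss.

Definition dist (m n : nat) : nat := (m - n) + (n - m).

(** The [q]-binomial theorem for 2n factors, with t = q^2, a = q^(2n) and
    b = z q.  The factors a + b t^k with k < n are q^(2k+1) (z + q^(2(n-k)-1)),
    and those with k = n + l are q^(2n) (1 + z q^(2l+1)); since
    i(i-1) + 2n(2n-i) + i = 3n^2 + (n-i)^2, a common factor q^(3n^2) cancels and
    leaves a sum centred at i = n. *)
Lemma finite_triple_product (R : idomainType) (z : R) n :
  \prod_(k < n) ((z%:P + 'X^(k.*2.+1)) * (1 + z%:P * 'X^(k.*2.+1))) =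
  \sum_(i < n.*2.+1)
     gauss_binomial 'X^2 n.*2 i * (z ^+ i)%:P * 'X^(dist n i ^ 2).
Proof.
have Xneq0 m : ('X^m : {poly R}) != 0 by rewrite monic_neq0 ?monicXn.
have sum_odd m : \sum_(k < m) k.*2.+1 = (m * m)%N.
  by elim: m => [|m IHm]; rewrite ?big_ord0 // big_ord_recr /= IHm; lia.
apply: (mulfI (Xneq0 (n * n * 3)%N)).
have:= gauss_binomial_theorem 'X^2 'X^(n.*2) (z%:P * 'X) n.*2.
rewrite big_distrr /= => E.
transitivity (\prod_(k < n.*2) ('X^(n.*2) + z%:P * 'X * 'X^2 ^+ k)).
  (* Keep the doubled exponent out of reach of the splitting of the range. *)
  set w := 'X^(n.*2); rewrite -[in RHS]addnn big_split_ord /=.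
  rewrite [X in _ = X * _](reindex_inj rev_ord_inj) -big_split /=.
  have -> : (n * n * 3 = \sum_(k < n) (rev_ord k).*2.+1 + \sum_(k < n) n.*2)%N.
    have -> : \sum_(k < n) (rev_ord k).*2.+1 = (n * n)%N.
      by rewrite -(sum_odd n) [RHS](reindex_inj rev_ord_inj).
    by rewrite sum_nat_const card_ord; lia.
  rewrite -big_split -prodrXr -big_split /=; apply: eq_bigr => k _.
  rewrite {}/w; have lt_kn := ltn_ord k.
  have -> : (n.*2 = (n - k.+1).*2.+1 + k.*2.+1)%N by lia.
  have -> : 'X^2 ^+ (n - k.+1) = 'X^((n - k.+1).*2) :> {poly R}.
    by rewrite -exprM mul2n.
  have -> : 'X^2 ^+ (n + k) = 'X^((n - k.+1).*2.+1 + k.*2.+1 + k.*2) :> {poly R}.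
    by rewrite -exprM; congr 'X^_; lia.
  by rewrite !exprD !(exprS _ (_.*2)); ring.
rewrite E; apply: eq_bigr => i _.
have le_i : (i <= n.*2)%N by rewrite -ltnS.
have Ei : ('C(i, 2) * 2 + i = i * i)%N.
  by have := mul_bin_left i 1; rewrite bin1; case: (nat_of_ord i) => // k; nia.
rewrite [(z%:P * _) ^+ i]exprMn -!exprM polyC_exp.
have -> : ('X^(n * n * 3) * (gauss_binomial 'X^2 n.*2 i * z%:P ^+ i *
   'X^(dist n i ^ 2)) = gauss_binomial 'X^2 n.*2 i * z%:P ^+ i *
   'X^(n * n * 3 + dist n i ^ 2) :> {poly R}) by rewrite exprD; ring.
rewrite (_ : n * n * 3 + dist n i ^ 2 = (2 * 'C(i, 2)) + n.*2 * (n.*2 - i) + i)%N.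
  by move: (2 * _)%N => e; rewrite !exprD; ring.
rewrite /dist; case: (leqP n i) => ?; nia.
Qed.

(** * Congruences modulo a power of the variable *)

Section Truncation.
Variable R : comNzRingType.
Implicit Types (p q u : {poly R}) (N d m n : nat).

Definition eqmodX N p q := forall i, (i < N)%N -> p`_i = q`_i.

Lemma eqmodX_trans N q p u : eqmodX N p q -> eqmodX N q u -> eqmodX N p u.
Proof. by move=> pq qu i ltiN; rewrite pq ?qu. Qed.

Lemma eqmodX_sym N p q : eqmodX N p q -> eqmodX N q p.
Proof. by move=> pq i ltiN; rewrite pq. Qed.

Lemma eqmodXW M N p q : (M <= N)%N -> eqmodX N p q -> eqmodX M p q.
Proof. by move=> leMN pq i /leq_trans/(_ leMN)/pq. Qed.

Lemma eqmodXM N p p' q q' :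
  eqmodX N p p' -> eqmodX N q q' -> eqmodX N (p * q) (p' * q').
Proof.
move=> pp qq i ltiN; rewrite !coefM; apply: eq_bigr => j _.
have := ltn_ord j; rewrite ltnS => leji.
by rewrite pp ?qq //; [apply: leq_ltn_trans ltiN; apply: leq_subr |
  apply: leq_ltn_trans ltiN].
Qed.

Lemma eqmodX_sum N I (r : seq I) (P : pred I) (F G : I -> {poly R}) :
  (forall i, P i -> eqmodX N (F i) (G i)) ->
  eqmodX N (\sum_(i <- r | P i) F i) (\sum_(i <- r | P i) G i).
Proof.
by move=> FG k ltkN; rewrite !coef_sum; apply: eq_bigr => i /FG; apply.
Qed.

Lemma eqmodX_prod N I (r : seq I) (P : pred I) (F G : I -> {poly R}) :
  (forall i, P i -> eqmodX N (F i) (G i)) ->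
  eqmodX N (\prod_(i <- r | P i) F i) (\prod_(i <- r | P i) G i).
Proof.
by move=> FG; apply: (big_ind2 (eqmodX N)) => // *; apply: eqmodXM.
Qed.

Lemma eqmodX_mulXn N d p q :
  eqmodX N p q -> eqmodX (N + d) (p * 'X^d) (q * 'X^d).
Proof.
move=> pq i lti; rewrite !coefMXn; case: ltnP => // led.
by apply: pq; rewrite ltn_subLR // addnC.
Qed.

Lemma eqmodX_addXn N p q : eqmodX N (p + q * 'X^N) p.
Proof. by move=> i ltiN; rewrite coefD coefMXn ltiN addr0. Qed.

(** A polynomial with constant term 1 is invertible modulo a power of 'X. *)
Lemma eqmodX_mulI N u p q :
  u`_0 = 1 -> eqmodX N (u * p) (u * q) -> eqmodX N p q.
Proof.
move=> u0 upq; elim/ltn_ind => i IHi ltiN.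
have := upq i ltiN; rewrite !coefM !big_ord_recl /= !subn0 u0 !mul1r.
rewrite [X in _ + X](_ : _ = \sum_(j < i) u`_(lift ord0 j) * q`_(i - lift ord0 j)).
  exact: addIr.
apply: eq_bigr => j _; have ltji := ltn_ord j.
by rewrite IHi // /bump /=; lia.
Qed.

Lemma pochhammer_stable n m :
  (n <= m)%N -> eqmodX n.*2.+2 (pochhammer 'X^2 m) (pochhammer ('X^2 : {poly R}) n).
Proof.
move=> /subnKC <-; elim: (m - n)%N => [|k IHk]; first by rewrite addn0.
apply: eqmodX_trans IHk; rewrite addnS pochhammerS -exprM.
rewrite (_ : 2 * _ = k.*2 + n.*2.+2)%N ?exprD; last by lia.
by rewrite mulrBr mulr1 mulrA -mulNr; apply: eqmodX_addXn.
Qed.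

Lemma pochhammer_coef0 n : (pochhammer ('X^2 : {poly R}) n)`_0 = 1.
Proof.
elim: n => [|n IHn]; first by rewrite /pochhammer big_ord0 coef1.
by rewrite pochhammerS coef0M IHn -exprM coefB coef1 coefXn mulnS subr0 mulr1.
Qed.

(** At distance d from the centre the factorial formula involves the Pochhammer
    symbols of n - d, n + d and 2n.  Those of n, n + d and 2n agree with that of
    n - d modulo q^(2(n-d)+2), so that the product of the first two factors is 1
    to that order.  The factor q^(d^2) compensates for the loss in d:
    2(n-d)+2 + d^2 = (d-1)^2 + 2n+1. *)
Lemma gauss_binomial_central n i : (i <= n.*2)%N ->
  eqmodX n.*2.+1
    (pochhammer 'X^2 n * gauss_binomial 'X^2 n.*2 i * 'X^(dist n i ^ 2))
    ('X^(dist n i ^ 2) : {poly R}).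
Proof.
move=> le_i; pose k := (n - dist n i)%N.
have kE : minn i (n.*2 - i) = k by rewrite /k /dist; lia.
have lkn : (k <= n)%N by exact: leq_subr.
have le_dn : (dist n i <= n)%N by rewrite /dist; lia.
suff eq1 : eqmodX k.*2.+2 (pochhammer 'X^2 n * gauss_binomial 'X^2 n.*2 i)
                   (1 : {poly R}).
  rewrite -[X in eqmodX _ _ X]mul1r.
  apply: (eqmodXW _ (eqmodX_mulXn eq1)).
  by have : (k + dist n i = n)%N; [rewrite /k; lia | nia].
apply: (eqmodX_mulI (pochhammer_coef0 k)).
have := @gauss_binomial_pochhammer {poly R} 'X^2 i (n.*2 - i).
rewrite subnKC //.
have -> : pochhammer 'X^2 i * pochhammer 'X^2 (n.*2 - i) =
  pochhammer 'X^2 k * pochhammer ('X^2 : {poly R}) (maxn i (n.*2 - i)).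
  by rewrite -kE; case: leqP => _ //; rewrite mulrC.
move=> E; apply: (@eqmodX_trans _ (pochhammer 'X^2 n.*2)); last first.
  by rewrite mulr1; apply: pochhammer_stable; lia.
rewrite -E (mulrC (gauss_binomial _ _ _)) mulrA.
apply: eqmodXM => //; apply: eqmodXM => //.
apply: (@eqmodX_trans _ (pochhammer 'X^2 k)); first exact: pochhammer_stable.
by apply/eqmodX_sym/pochhammer_stable; lia.
Qed.
End Truncation.

(** * The theta series at -1 and at a primitive cube root of unity *)

Lemma triple_product_mod (R : idomainType) (z : R) n :
  eqmodX n.*2.+1
    (pochhammer 'X^2 n *
      \prod_(k < n) ((z%:P + 'X^(k.*2.+1)) * (1 + z%:P * 'X^(k.*2.+1))))
    (\sum_(i < n.*2.+1) (z ^+ i)%:P * 'X^(dist n i ^ 2)).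
Proof.
rewrite finite_triple_product big_distrr; apply: eqmodX_sum => i _.
rewrite /= (_ : pochhammer _ _ * _ = (z ^+ i)%:P * (pochhammer 'X^2 n *
  gauss_binomial 'X^2 n.*2 i * 'X^(dist n i ^ 2))); last by ring.
by apply: eqmodXM => //; apply: gauss_binomial_central; rewrite -ltnS.
Qed.

(** For w^2 + w + 1 = 0 one has (w + x)(1 + w x) = w (1 - x + x^2).  The product
    and the claim are integral, so the identity over the algebraic numbers can be
    compared coefficientwise with the integer polynomial. *)
Lemma cube_root_theta n m : (m < n.*2.+1)%N -> (forall d, m <> d ^ 2)%N ->
  (pochhammer 'X^2 n *
     \prod_(k < n) (1 - 'X^(k.*2.+1) + 'X^(k.*2.+1) ^+ 2) : {poly int})`_m = 0.
Proof.
move=> ltm nsq.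
have [w w_root] : exists w : algC, w ^+ 2 + w + 1 = 0.
  have [w] := @solve_monicpoly algC 2 (fun=> -1) isT.
  by rewrite !big_ord_recl big_ord0 /= expr0 => ww; exists w; rewrite ww; ring.
have w_neq0 : w != 0.
  by apply: contra_eq_neq w_root => ->; rewrite expr0n /= !add0r oner_neq0.
have map_poch : map_poly intr (pochhammer 'X^2 n) = pochhammer 'X^2 n :> {poly algC}.
  rewrite /pochhammer rmorph_prod; apply: eq_bigr => i _.
  by rewrite rmorphB rmorph1 !rmorphXn /= map_polyX.
have map_prod : map_poly intr (\prod_(k < n) (1 - 'X^(k.*2.+1) + 'X^(k.*2.+1) ^+ 2)) =
    \prod_(k < n) (1 - 'X^(k.*2.+1) + 'X^(k.*2.+1) ^+ 2) :> {poly algC}.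
  rewrite rmorph_prod; apply: eq_bigr => i _.
  by rewrite rmorphD rmorphB rmorph1 !rmorphXn /= map_polyX.
apply: (@intr_inj algC); rewrite -coef_map rmorphM /= map_poch map_prod.
have := @triple_product_mod _ w n m ltm; rewrite coef_sum [X in _ = X]big1.
  have -> : \prod_(k < n) ((w%:P + 'X^(k.*2.+1)) * (1 + w%:P * 'X^(k.*2.+1))) =
      (w ^+ n)%:P * \prod_(k < n) (1 - 'X^(k.*2.+1) + 'X^(k.*2.+1) ^+ 2).
    rewrite -[X in w ^+ X](card_ord n) -prodr_const rmorph_prod -big_split /=.
    apply: eq_bigr => k _.
    have : (w ^+ 2 + w + 1)%:P = 0 :> {poly algC} by rewrite w_root.
    rewrite !rmorphD rmorphXn rmorph1 /= => wP.
    rewrite -[RHS]addr0 -(mul0r 'X^(k.*2.+1)) -wP; ring.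
  rewrite mulrCA coefCM => /eqP; rewrite mulf_eq0 expf_eq0 (negPf w_neq0) andbF /=.
  by move/eqP.
by move=> i _; rewrite coefCM coefXn; case: eqP => [/nsq//|]; rewrite mulr0.
Qed.

Lemma sum_around (V : zmodType) (F : nat -> V) n :
  \sum_(i < n.*2.+1) F i = F n + \sum_(d < n) (F (n - d.+1)%N + F (n + d.+1)%N).
Proof.
elim: n F => [|n IHn] F; first by rewrite big_ord1 big_ord0 addr0.
rewrite doubleS big_ord_recl big_ord_recr /=.
under eq_bigr do rewrite /bump leq0n add1n.
rewrite (IHn (fun i => F i.+1)) [in RHS]big_ord_recr /= subnn.
under [in RHS]eq_bigr => d _.
  rewrite (_ : n.+1 - d.+1 = (n - d.+1).+1)%N; last by have := ltn_ord d; lia.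
  rewrite addSn; over.
rewrite /bump leq0n add1n addnn doubleS.
by rewrite !addrA [RHS](ACl (3*1*2*4)).
Qed.

(** At z = -1 the terms at n - d and n + d coincide, hence the factor 2. *)
Lemma minus_one_theta n : exists S : {poly int},
  eqmodX n.*2.+1 (pochhammer 'X^2 n * \prod_(k < n) (1 - 'X^(k.*2.+1)) ^+ 2)
    (1 + S *+ 2) /\
  forall m, (forall d, m <> d ^ 2)%N -> (1 + S *+ 2)`_m = 0.
Proof.
exists (\sum_(d < n) ((-1) ^+ d.+1)%:P * 'X^(d.+1 ^ 2)); split; last first.
  move=> m nsq; rewrite coefD coefMn coef_sum coef1 big1 => [|i _].
    by case: m nsq => // /(_ 0%N).
  by rewrite coefCM coefXn; case: eqP => [/nsq//|]; rewrite mulr0.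
have sgn_prod : \prod_(k < n) (((-1)%:P + 'X^(k.*2.+1)) * (1 + (-1)%:P * 'X^(k.*2.+1))) =
   ((-1) ^+ n)%:P * \prod_(k < n) (1 - 'X^(k.*2.+1)) ^+ 2 :> {poly int}.
  rewrite -[X in _ ^+ X](card_ord n) -prodr_const rmorph_prod -big_split /=.
  by apply: eq_bigr => k _; rewrite rmorphN1; ring.
have := @triple_product_mod int (-1) n; rewrite sgn_prod => th.
have sgn2 : ((-1) ^+ n)%:P * ((-1) ^+ n)%:P = 1 :> {poly int}.
  by rewrite -polyCM -expr2 sqrr_sign.
have -> : pochhammer 'X^2 n * \prod_(k < n) (1 - 'X^(k.*2.+1)) ^+ 2 =
  ((-1) ^+ n)%:P * (pochhammer 'X^2 n * (((-1) ^+ n)%:P *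
   \prod_(k < n) (1 - 'X^(k.*2.+1)) ^+ 2)) :> {poly int}.
  by rewrite -[LHS]mul1r -sgn2; ring.
rewrite (_ : 1 + _ = ((-1) ^+ n)%:P *
    \sum_(i < n.*2.+1) ((-1) ^+ i)%:P * 'X^(dist n i ^ 2)).
  exact: eqmodXM.
rewrite (sum_around (fun i => ((-1) ^+ i)%:P * 'X^(dist n i ^ 2))) mulrDr mulrA.
rewrite sgn2 mul1r /dist subnn expr0 -sumrMnl mulr_sumr; congr (_ + _).
apply: eq_bigr => d _; have ltdn := ltn_ord d.
rewrite (_ : n - (n - d.+1) + (n - d.+1 - n) = d.+1)%N; last by lia.
rewrite (_ : n - (n + d.+1) + (n + d.+1 - n) = d.+1)%N; last by lia.
rewrite mulrDr !mulrA -!polyCM -!exprD.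
rewrite -(signr_odd _ (n + (n - d.+1))) -(signr_odd _ (n + (n + d.+1))).
rewrite -(signr_odd _ d.+1).
rewrite (_ : odd (n + (n - d.+1)) = odd d.+1); last by lia.
by rewrite (_ : odd (n + (n + d.+1)) = odd d.+1); last by lia.
Qed.

(** * Divisibility by 4 *)

(** This is the identity A D = T. *)
Lemma odd_designated_product k N :
  eqmodX N.+1
    ((\prod_(j < k) block_series N j.*2.+1) *
     \prod_(j < k) (1 - 'X^(j.*2.+1)) ^+ 2)
    (\prod_(j < k) (1 - 'X^(j.*2.+1) + 'X^(j.*2.+1) ^+ 2)).
Proof.
rewrite -big_split; apply: eqmodX_prod => j _ /=.
rewrite block_series_mul -mulNr -[X in _ * X]exprM mulSn addnC exprD mulrA.
exact: eqmodX_addXn.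
Qed.

(** Multiplying A (1 + 2S) = P T once more by 1 + 2S replaces the left-hand side
    by A + 4 A (S + S^2).  A nonzero coefficient of degree N on the other side
    would write N as a sum of two exponents that are both squares. *)
Lemma PD2_mod4 N :
  (forall a b, N <> a ^ 2 + b ^ 2)%N -> (4 %| PD2 N)%N.
Proof.
move=> nsq; have N_gt0 : (0 < N)%N by case: (N) nsq => // /(_ 0%N 0%N).
have ltN : (N < N.*2)%N by lia.
pose A := \prod_(j < N) block_series N j.*2.+1.
pose P : {poly int} := pochhammer 'X^2 N.
pose D : {poly int} := \prod_(j < N) (1 - 'X^(j.*2.+1)) ^+ 2.
pose T : {poly int} := P * \prod_(j < N) (1 - 'X^(j.*2.+1) + 'X^(j.*2.+1) ^+ 2).
have [S [thS offS]] := minus_one_theta N.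
pose Phi := 1 + S *+ 2.
have leN : (N.+1 <= N.*2.+1)%N by lia.
have APhi : eqmodX N.+1 (A * Phi * Phi) (T * Phi).
  apply: eqmodXM => //; apply: (@eqmodX_trans _ _ (A * (P * D))).
    by apply: eqmodXM => //; apply: eqmodXW leN (eqmodX_sym thS).
  rewrite mulrCA; apply: eqmodXM => //; exact: odd_designated_product.
have TPhi0 : (T * Phi)`_N = 0.
  rewrite coefM big1 // => i _.
  have [/existsP[d /eqP id2]|nsq_i] :=
    boolP [exists d : 'I_N.+1, i == d ^ 2 :> nat]%N.
    rewrite offS ?mulr0 // => e Ni; apply: (nsq d e).
    by have := ltn_ord i; lia.
  rewrite cube_root_theta ?mul0r // => [|d id2]; first by have := ltn_ord i; lia.
  case/negP: nsq_i; apply/existsP.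
  have ltd : (d < N.+1)%N by have := ltn_ord i; nia.
  by exists (Ordinal ltd); rewrite /= -id2.
have := APhi N (ltnSn N); rewrite TPhi0.
rewrite (_ : A * Phi * Phi = A + (A * (S + S ^+ 2)) *+ 4); last by rewrite /Phi; ring.
rewrite coefD coefMn coef_block_series_prod // -PD2_odd_designated // => /eqP.
rewrite addr_eq0 => /eqP PD2E.
have : (4%:Z %| (PD2 N)%:Z)%Z.
  by apply/dvdzP; exists (- (A * (S + S ^+ 2))`_N); rewrite -natz PD2E; ring.
by rewrite dvdzE.
Qed.

Local Open Scope nat_scope.

(** For odd numbers this is arithmetic modulo 4.  If 2N = a^2 + b^2 then a and b
    have the same parity and N = ((a+b)/2)^2 + ((a-b)/2)^2, which is the descent
    on [alpha]. *)
Lemma not_sum_two_squares alpha n a b :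
  2 ^ alpha * (4 * n + 3) <> a ^ 2 + b ^ 2.
Proof.
elim: alpha a b => [|alpha IH] a b.
  have sq4 c : exists d, c ^ 2 = 4 * d + odd c.
    exists ((c./2 + odd c) * c./2); have := odd_double_half c.
    by case: (odd c); nia.
  have [[c ->] [d ->]] := (sq4 a, sq4 b).
  by case: (odd a); case: (odd b); lia.
wlog le_ba : a b / b <= a => [hw|].
  case: (leqP b a) => [|/ltnW] le_ab; first exact: hw.
  by rewrite [X in _ <> X]addnC; apply: hw.
rewrite expnS => E; have odd_ab : odd (a - b) = false.
  rewrite oddB //; have := congr1 odd E.
  rewrite -mulnA oddM /= oddD -!mulnn !oddM !andbb => /esym/negbT.
  by case: (odd a) (odd b) => [] [].
apply: (IH (b + (a - b)./2) (a - b)./2).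
have : a = b + (a - b)./2.*2 by lia.
by move: (a - b)./2 E => c E aE; move: E; rewrite {}aE; nia.
Qed.

Unset Implicit Arguments.

Theorem theorem1p2 (alpha n : nat) :
  PD2 (2 ^ alpha * (4 * n + 3)) = 0 %[mod 4].
Proof.
apply/eqP; rewrite mod0n; apply/PD2_mod4 => a b.
exact: not_sum_two_squares.
Qed.
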